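(* Let $n\ge 3$, $1<k<n/2$ and $p>p_{so}:=\frac{(n+2)k}{n-2k}$. Then every regular solution $u_\mu$ of (1.6) satisfies $u_\mu(r)\simeq r^{-\frac{2k}{p-k}}$ for large $r$, i.e. there is $C>1$ with $\frac1C\le u_\mu(r)r^{\frac{2k}{p-k}}\le C$ for all sufficiently large $r$. Moreover, every regular solution has the form $u_\mu(r)=\mu^{\frac{2k}{p-k}}u_1(\mu r)$, $r\ge 0$, for some $\mu>0$, where $u_1$ is the solution of (1.6) with $\rho=1$ (i.e. $u_1(0)=1$, $u_1'(0)=0$).
   Context: Here $C_{n-1}^{k-1}$ denotes the binomial coefficient. Problem (1.6) is: given $\rho>0$, find $u$ with $$-\tfrac{1}{k}C_{n-1}^{k-1}\big(r^{n-k}|u'|^{k-1}u'\big)'=r^{n-1}u^{p},\quad u(r)>0 \text{ for all } r>0,\qquad u'(0)=0,\ u(0)=\rho .$$ A solution $u$ of (1.6) is called regular if the function $x\mapsto u(|x|)$ belongs to $C^2(\mathbb{R}^n)$. *)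

(* Defs.v *)
From Stdlib Require Import Reals Lra.
Open Scope R_scope.

(* Points of R^n are represented as functions nat -> R; only the first n
   coordinates are used (continuity below is w.r.t. those coordinates). *)

Fixpoint sqsum (n : nat) (x : nat -> R) : R :=
  match n with
  | O => 0
  | S m => sqsum m x + x m ^ 2
  end.

Definition update (x : nat -> R) (i : nat) (t : R) : nat -> R :=
  fun j => if Nat.eqb j i then t else x j.

Definition is_partial (F : (nat -> R) -> R) (i : nat) (x : nat -> R) (l : R) : Prop :=
  derivable_pt_lim (fun t => F (update x i t)) (x i) l.

Definition Rn_continuous (n : nat) (G : (nat -> R) -> R) : Prop :=
  forall x eps, 0 < eps -> exists delta, 0 < delta /\
    forall y, sqsum n (fun i => y i - x i) < delta ^ 2 -> Rabs (G y - G x) < eps.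

Definition C2_Rn (n : nat) (F : (nat -> R) -> R) : Prop :=
  exists (D1 : nat -> (nat -> R) -> R) (D2 : nat -> nat -> (nat -> R) -> R),
    Rn_continuous n F /\
    (forall i x, (i < n)%nat -> is_partial F i x (D1 i x)) /\
    (forall i j x, (i < n)%nat -> (j < n)%nat -> is_partial (D1 i) j x (D2 i j x)) /\
    (forall i, (i < n)%nat -> Rn_continuous n (D1 i)) /\
    (forall i j, (i < n)%nat -> (j < n)%nat -> Rn_continuous n (D2 i j)).

Definition radial (n : nat) (u : R -> R) : (nat -> R) -> R :=
  fun x => u (sqrt (sqsum n x)).

(* u is a solution of problem (1.6) with parameters n, k, p and initial value rho:
   -(1/k) C_{n-1}^{k-1} (r^{n-k} |u'|^{k-1} u')' = r^{n-1} u^p  for r > 0,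
   u(r) > 0 for r > 0, u'(0) = 0 (right derivative), u(0) = rho.
   Only the values of u on [0, +oo) are relevant. *)
Definition solution16 (n k : nat) (p rho : R) (u : R -> R) : Prop :=
  u 0 = rho /\
  (forall r, 0 < r -> 0 < u r) /\
  (forall eps, 0 < eps -> exists delta, 0 < delta /\
     forall h, 0 < h < delta -> Rabs ((u h - u 0) / h) < eps) /\
  exists du : R -> R,
    (forall r, 0 < r -> derivable_pt_lim u r (du r)) /\
    (forall r, 0 < r -> exists L,
        derivable_pt_lim (fun s => s ^ (n - k) * Rabs (du s) ^ (k - 1) * du s) r L /\
        - (1 / INR k) * C (n - 1) (k - 1) * L = r ^ (n - 1) * Rpower (u r) p).

Definition regular_solution16 (n k : nat) (p rho : R) (u : R -> R) : Prop :=
  solution16 n k p rho u /\ C2_Rn n (radial n u).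

(* Main.v *)
Require Import Defs.
From Stdlib Require Import Reals Lra Lia.
Open Scope R_scope.

(** The equation degenerates at [r = 0]: recovering [u'] from the flux takes a [k]-th root, not
    Lipschitz at 0, and [1/r] terms appear. All arguments therefore live on [r > 0], with right
    limits at 0, and linear bounds [a r <= - u' <= A r] compensate the degeneracy. The exponent
    [alpha = 2k/(p-k)] is the one for which scaling preserves the equation, so [x] solves a system
    autonomous in [ln r]. With [z = - r^(alpha+1) u'] and [beta = n - 2k - alpha k], the Pohozaev
    energy alone has derivative [(beta - alpha) (alpha x - z) z^k] in [ln r], which has no sign. The
    correction replaces [z^k] by [z^k - (alpha x)^k], of sign opposite to [alpha x - z]. The
    condition [p > p_so] is [alpha < beta]. *)

Lemma Rpower_pos (x a : R) : 0 < Rpower x a.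
Proof. apply exp_pos. Qed.

(** Regularity makes [u'] bounded near 0, so the flux [W = r^(n-k) (-u')^k] starts
    from 0 and [u] decreases.  Monotonicity of [u] gives [W >= u^p r^n / (c n)], a
    differential inequality for [u^(1-p/k)] whose integration is the upper bound
    on [x = r^alpha u].  In Emden-Fowler variables the Pohozaev energy, corrected by a
    multiple of [x^(k+1)], is nonincreasing exactly when [p >= p_so]; it is negative
    near [r = 0], hence stays away from 0, while it is at least [- D x^(k+1)]; this
    keeps [x] away from 0.  The scaling form follows from uniqueness for the
    singular initial value problem. *)

(** * Powers, roots and derivatives *)

Lemma Rabs_div_pos (a b : R) : 0 < b -> Rabs (a / b) = Rabs a / b.
Proof.
  intros Hb. unfold Rdiv. rewrite Rabs_mult, (Rabs_pos_eq (/ b)); [reflexivity|].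
  left. now apply Rinv_0_lt_compat.
Qed.

Lemma Rpower_pow_root (k : nat) (y : R) :
  (0 < k)%nat -> 0 < y -> Rpower (y ^ k) (1 / INR k) = y.
Proof.
  intros Hk Hy.
  assert (0 < INR k) by (apply lt_0_INR; lia).
  rewrite <- Rpower_pow by assumption. rewrite Rpower_mult.
  replace (INR k * (1 / INR k)) with 1 by (field; lra).
  now apply Rpower_1.
Qed.

Lemma pow_Rpower_root (k : nat) (y : R) :
  (0 < k)%nat -> 0 < y -> Rpower y (1 / INR k) ^ k = y.
Proof.
  intros Hk Hy.
  assert (0 < INR k) by (apply lt_0_INR; lia).
  rewrite <- Rpower_pow by apply Rpower_pos. rewrite Rpower_mult.
  replace (1 / INR k * INR k) with 1 by (field; lra).
  now apply Rpower_1.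
Qed.

Lemma Rpower_le_base (x y a : R) : 0 <= a -> 0 < x -> x <= y -> Rpower x a <= Rpower y a.
Proof. intros. apply Rle_Rpower_l; lra. Qed.

Lemma pow_le_reg (k : nat) (x y : R) :
  (0 < k)%nat -> 0 <= x -> 0 <= y -> x ^ k <= y ^ k -> x <= y.
Proof.
  intros Hk Hx Hy H. destruct (Rle_lt_dec x y) as [|Hlt]; [assumption|].
  exfalso. destruct k as [|k]; [lia|].
  assert (H1 : y ^ k <= x ^ k) by (apply pow_incr; lra).
  assert (H2 : 0 < x ^ k) by (apply pow_lt; lra).
  simpl in H. nra.
Qed.

(** For [a >= b >= t], [a^(k+1) - b^(k+1) >= (a - b) a^k]. It serves uniqueness, where differences
    of [V] must be controlled by differences of [V^k]. *)
Lemma pow_sub_ge (k : nat) (t x y : R) :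
  0 < t -> t <= x -> t <= y -> Rabs (x - y) * t ^ k <= Rabs (x ^ S k - y ^ S k).
Proof.
  intros Ht.
  assert (Hord : forall a b, t <= b -> b <= a -> (a - b) * t ^ k <= a ^ S k - b ^ S k).
  { intros a b Hb Hab. simpl.
    assert (b ^ k <= a ^ k) by (apply pow_incr; lra).
    assert (t ^ k <= b ^ k) by (apply pow_incr; lra).
    nra. }
  intros Hx Hy. destruct (Rle_lt_dec y x) as [H|H].
  - rewrite (Rabs_pos_eq (x - y)) by lra.
    eapply Rle_trans; [apply Hord; lra | apply Rle_abs].
  - rewrite (Rabs_minus_sym x y), (Rabs_minus_sym (x ^ S k)).
    rewrite (Rabs_pos_eq (y - x)) by lra.
    eapply Rle_trans; [apply Hord; lra | apply Rle_abs].
Qed.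

Lemma derivable_pt_lim_Rpower_comp (f : R -> R) (a r l : R) :
  0 < f r -> derivable_pt_lim f r l ->
  derivable_pt_lim (fun s => Rpower (f s) a) r (a * Rpower (f r) (a - 1) * l).
Proof.
  intros Hf Hl.
  apply (derivable_pt_lim_comp f (fun y => Rpower y a)); [assumption|].
  now apply derivable_pt_lim_power.
Qed.

Lemma derivable_pt_lim_pow_comp (f : R -> R) (m : nat) (r l : R) :
  derivable_pt_lim f r l ->
  derivable_pt_lim (fun s => f s ^ m) r (INR m * f r ^ pred m * l).
Proof.
  intros Hl.
  apply (derivable_pt_lim_comp f (fun y => y ^ m)); [assumption|].
  apply derivable_pt_lim_pow.
Qed.

Lemma derivable_pt_lim_scale_arg (f : R -> R) (a r l : R) :
  derivable_pt_lim f (a * r) l -> derivable_pt_lim (fun s => f (a * s)) r (a * l).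
Proof.
  intros H.
  replace (a * l) with (l * (a * 1)) by ring.
  apply (derivable_pt_lim_comp (fun s => a * s) f); [|assumption].
  apply derivable_pt_lim_scal, derivable_pt_lim_id.
Qed.

Lemma derivable_pt_lim_value (f : R -> R) (x l l' : R) :
  derivable_pt_lim f x l -> l = l' -> derivable_pt_lim f x l'.
Proof. now intros H <-. Qed.

Lemma derivable_pt_lim_local_ext (f g : R -> R) (x l d : R) :
  0 < d -> (forall s, Rabs (s - x) < d -> f s = g s) ->
  derivable_pt_lim f x l -> derivable_pt_lim g x l.
Proof.
  intros Hd Hfg H eps Heps. destruct (H eps Heps) as [e He].
  assert (Hm : 0 < Rmin d e) by (apply Rmin_pos; [assumption | apply cond_pos]).
  exists (mkposreal _ Hm). intros h Hh0 Hh. simpl in Hh.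
  rewrite <- !Hfg.
  - apply He; [assumption|]. eapply Rlt_le_trans; [exact Hh | apply Rmin_r].
  - replace (x - x) with 0 by ring. now rewrite Rabs_R0.
  - replace (x + h - x) with h by ring.
    eapply Rlt_le_trans; [exact Hh | apply Rmin_l].
Qed.

Lemma derivable_pt_lim_div_pow (f : R -> R) (m : nat) (r l : R) :
  0 < r -> derivable_pt_lim f r l ->
  derivable_pt_lim (fun s => f s / s ^ m) r
    (l / r ^ m - INR m * (f r / r ^ m) / r).
Proof.
  intros Hr Hl.
  assert (Hm : 0 < r ^ m) by now apply pow_lt.
  eapply derivable_pt_lim_value.
  - apply (derivable_pt_lim_div f (fun s => s ^ m)); [exact Hl | apply derivable_pt_lim_pow | lra].
  - destruct m as [|m]; [unfold Rsqr; simpl; field; lra|].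
    assert (0 < r ^ m) by now apply pow_lt.
    cbv beta. simpl pred. unfold Rsqr. change (r ^ S m) with (r * r ^ m). field. lra.
Qed.

Lemma derive_nonpos_le (f f' : R -> R) (a b : R) :
  a <= b -> (forall s, a <= s <= b -> derivable_pt_lim f s (f' s)) ->
  (forall s, a < s < b -> f' s <= 0) -> f b <= f a.
Proof.
  intros Hab Hd Hneg. destruct (Req_dec a b) as [->|Hne]; [lra|].
  destruct (MVT_cor2 f f' a b) as [c [Hc1 Hc2]]; [lra | assumption |].
  specialize (Hneg c Hc2). nra.
Qed.

(** * Right limits at 0 and monotonicity from the singular endpoint *)

Definition rlim0 (f : R -> R) (l : R) : Prop :=
  forall eps, 0 < eps -> exists d, 0 < d /\ forall s, 0 < s < d -> Rabs (f s - l) < eps.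

(** If [f r > l], then [f s >= f r] for all small [s], against the limit. Nothing is asked of [f] at
    0 itself. *)
Lemma derive_nonpos_rlim0 (f f' : R -> R) (l r : R) :
  0 < r -> rlim0 f l -> (forall s, 0 < s <= r -> derivable_pt_lim f s (f' s)) ->
  (forall s, 0 < s < r -> f' s <= 0) -> f r <= l.
Proof.
  intros Hr Hlim Hd Hneg. apply Rnot_lt_le; intros Hlt.
  destruct (Hlim (f r - l)) as [d [Hd0 Hs]]; [lra|].
  set (s := Rmin (d / 2) (r / 2)).
  assert (Hs1 : 0 < s) by (apply Rmin_pos; lra).
  assert (Hs2 : s <= d / 2) by apply Rmin_l.
  assert (Hs3 : s <= r / 2) by apply Rmin_r.
  assert (H1 : f r <= f s).
  { apply derive_nonpos_le with f'; [lra | |]; intros; [apply Hd | apply Hneg]; lra. }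
  specialize (Hs s ltac:(lra)). apply Rabs_def2 in Hs. lra.
Qed.

Lemma rlim0_linear_bound (f : R -> R) (l B d0 : R) :
  0 < d0 -> (forall s, 0 < s < d0 -> Rabs (f s - l) <= B * s) -> rlim0 f l.
Proof.
  intros Hd0 H eps Heps.
  assert (HB : 0 < Rabs B + 1) by (pose proof (Rabs_pos B); lra).
  exists (Rmin d0 (eps / (Rabs B + 1))). split.
  - apply Rmin_pos; [assumption|]. now apply Rdiv_lt_0_compat.
  - intros s [Hs1 Hs2].
    pose proof (Rmin_l d0 (eps / (Rabs B + 1))). pose proof (Rmin_r d0 (eps / (Rabs B + 1))).
    eapply Rle_lt_trans; [apply H; lra|].
    pose proof (Rle_abs B).
    assert (s * (Rabs B + 1) < eps).
    { replace eps with (eps / (Rabs B + 1) * (Rabs B + 1)) by (field; lra).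
      apply Rmult_lt_compat_r; lra. }
    nra.
Qed.

(** * The first-order system for decreasing solutions, where [r^(n-k) |u'|^(k-1) u' = - flux] *)

Definition flux (n k : nat) (V : R -> R) : R -> R := fun s => s ^ (n - k) * V s ^ k.

(* [V] plays the role of [- u']. *)
Record radial_flow (n k : nat) (p c rho : R) (u V : R -> R) : Prop := {
  rf_u_pos : forall r, 0 < r -> 0 < u r;
  rf_V_pos : forall r, 0 < r -> 0 < V r;
  rf_u_der : forall r, 0 < r -> derivable_pt_lim u r (- V r);
  rf_flux_der : forall r, 0 < r ->
    derivable_pt_lim (flux n k V) r (r ^ (n - 1) * Rpower (u r) p / c);
  rf_u_lim : rlim0 u rho;
  rf_flux_lim : rlim0 (flux n k V) 0 }.

Section Flow.
Variables (n k : nat) (p c : R).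
Hypotheses (Hk : (1 < k)%nat) (Hkn : (2 * k < n)%nat) (Hpk : INR k < p) (Hc : 0 < c).

Let Kpos : 1 < INR k.
Proof. change 1 with (INR 1). now apply lt_INR. Qed.

Let Npos : 0 < INR n.
Proof. apply lt_0_INR; lia. Qed.

Section OneFlow.
Variables (rho : R) (u V : R -> R).
Hypothesis HF : radial_flow n k p c rho u V.

(** * Monotonicity and flux comparison *)

Lemma flow_u_decr (a b : R) : 0 < a -> a <= b -> u b <= u a.
Proof.
  intros Ha Hab. apply derive_nonpos_le with (fun s => - V s); [assumption | |].
  - intros s Hs. apply (rf_u_der _ _ _ _ _ _ _ HF). lra.
  - intros s Hs. pose proof (rf_V_pos _ _ _ _ _ _ _ HF s ltac:(lra)). lra.
Qed.

Lemma flow_u_le (r : R) : 0 < r -> u r <= rho.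
Proof.
  intros Hr. apply derive_nonpos_rlim0 with (fun s => - V s); [assumption | | |].
  - apply (rf_u_lim _ _ _ _ _ _ _ HF).
  - intros s Hs. apply (rf_u_der _ _ _ _ _ _ _ HF). lra.
  - intros s Hs. pose proof (rf_V_pos _ _ _ _ _ _ _ HF s ltac:(lra)). lra.
Qed.

Lemma flow_rho_pos : 0 < rho.
Proof.
  pose proof (flow_u_le 1 ltac:(lra)). pose proof (rf_u_pos _ _ _ _ _ _ _ HF 1 ltac:(lra)). lra.
Qed.

Lemma rlim0_flux_sub (a : R) : rlim0 (fun s => flux n k V s - a * s ^ n) 0.
Proof.
  intros eps Heps.
  destruct (rf_flux_lim _ _ _ _ _ _ _ HF (eps / 2)) as [d1 [Hd1 H1]]; [lra|].
  destruct (rlim0_linear_bound (fun s => a * s ^ n) 0 (Rabs a) 1) with (eps / 2)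
    as [d2 [Hd2 H2]]; [lra | | lra |].
  { intros s Hs. rewrite Rminus_0_r, Rabs_mult.
    apply Rmult_le_compat_l; [apply Rabs_pos|].
    replace n with (S (n - 1)) by lia. simpl.
    assert (0 < s ^ (n - 1)) by (apply pow_lt; lra).
    assert (s ^ (n - 1) <= 1 ^ (n - 1)) by (apply pow_incr; lra).
    rewrite pow1 in *. rewrite Rabs_pos_eq; nra. }
  exists (Rmin d1 d2). split; [now apply Rmin_pos|].
  intros s Hs. pose proof (Rmin_l d1 d2). pose proof (Rmin_r d1 d2).
  specialize (H1 s ltac:(lra)). specialize (H2 s ltac:(lra)).
  apply Rabs_def2 in H1, H2. apply Rabs_def1; lra.
Qed.

(** [a s^n / (c n)] is the flux produced by freezing [u^p] at the value [a]. Taking [a = rho^p] and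
    [a = (u r)^p] gives the two flux bounds. *)
Lemma flux_sub_der (a s : R) : 0 < s ->
  derivable_pt_lim (fun s => flux n k V s - a / (c * INR n) * s ^ n) s
    (s ^ (n - 1) * (Rpower (u s) p - a) / c).
Proof.
  intros Hs. eapply derivable_pt_lim_value.
  - apply derivable_pt_lim_minus.
    + apply (rf_flux_der _ _ _ _ _ _ _ HF); assumption.
    + apply derivable_pt_lim_scal, derivable_pt_lim_pow.
  - replace (pred n) with (n - 1)%nat by lia. field. lra.
Qed.

Lemma flux_le (r : R) : 0 < r -> flux n k V r <= Rpower rho p / (c * INR n) * r ^ n.
Proof.
  intros Hr. apply Rminus_le.
  apply derive_nonpos_rlim0 with
    (f := fun s => flux n k V s - Rpower rho p / (c * INR n) * s ^ n)
    (f' := fun s => s ^ (n - 1) * (Rpower (u s) p - Rpower rho p) / c); [assumption | | |].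
  - apply rlim0_flux_sub.
  - intros s Hs. apply flux_sub_der. lra.
  - intros s Hs.
    assert (Rpower (u s) p <= Rpower rho p).
    { apply Rpower_le_base; [lra | | apply flow_u_le; lra].
      apply (rf_u_pos _ _ _ _ _ _ _ HF). lra. }
    assert (0 < s ^ (n - 1)) by (apply pow_lt; lra).
    assert (0 < / c) by now apply Rinv_0_lt_compat.
    unfold Rdiv. assert (0 < s ^ (n - 1) * / c) by nra. nra.
Qed.

Lemma flux_ge (r : R) : 0 < r -> Rpower (u r) p / (c * INR n) * r ^ n <= flux n k V r.
Proof.
  intros Hr. apply Rminus_le.
  apply derive_nonpos_rlim0 with
    (f := fun s => Rpower (u r) p / (c * INR n) * s ^ n - flux n k V s)
    (f' := fun s => - (s ^ (n - 1) * (Rpower (u s) p - Rpower (u r) p) / c)); [assumption | | |].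
  - intros eps Heps. destruct (rlim0_flux_sub (Rpower (u r) p / (c * INR n)) eps Heps)
      as [d [Hd H]].
    exists d. split; [assumption|]. intros s Hs. rewrite <- Rabs_Ropp.
    replace (- _) with (flux n k V s - Rpower (u r) p / (c * INR n) * s ^ n - 0) by ring.
    now apply H.
  - intros s Hs.
    apply derivable_pt_lim_local_ext
      with (f := fun s => - (flux n k V s - Rpower (u r) p / (c * INR n) * s ^ n)) (d := 1);
      [lra | intros; ring |].
    apply derivable_pt_lim_opp, flux_sub_der. lra.
  - intros s Hs.
    assert (Rpower (u r) p <= Rpower (u s) p).
    { apply Rpower_le_base; [lra | | apply flow_u_decr; lra].
      now apply (rf_u_pos _ _ _ _ _ _ _ HF). }
    assert (0 < s ^ (n - 1)) by (apply pow_lt; lra).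
    assert (0 < / c) by now apply Rinv_0_lt_compat.
    unfold Rdiv. assert (0 < s ^ (n - 1) * / c) by nra. nra.
Qed.

Lemma pow_split (r : R) : r ^ n = r ^ (n - k) * r ^ k.
Proof. rewrite <- pow_add. f_equal. lia. Qed.

Lemma V_le (r : R) : 0 < r ->
  V r <= Rpower (Rpower rho p / (c * INR n)) (1 / INR k) * r.
Proof.
  intros Hr.
  assert (Hb : 0 < Rpower rho p / (c * INR n)).
  { apply Rdiv_lt_0_compat; [apply Rpower_pos | nra]. }
  apply pow_le_reg with k; [lia | | |].
  - left. now apply (rf_V_pos _ _ _ _ _ _ _ HF).
  - pose proof (Rpower_pos (Rpower rho p / (c * INR n)) (1 / INR k)). nra.
  - rewrite Rpow_mult_distr, pow_Rpower_root by (assumption || lia).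
    pose proof (flux_le r Hr) as H. unfold flux in H. rewrite pow_split in H.
    apply Rmult_le_reg_l with (r ^ (n - k)); [now apply pow_lt | lra].
Qed.

(** The level [m] is left free: [m = u r] yields the differential inequality for [u], while a common
    [m] gives one slope valid for two solutions at once. *)
Lemma V_ge (m r : R) : 0 < r -> 0 < m -> m <= u r ->
  Rpower (Rpower m p / (c * INR n)) (1 / INR k) * r <= V r.
Proof.
  intros Hr Hm Hmu.
  assert (Hcn : 0 < c * INR n) by nra.
  assert (Hb : 0 < Rpower m p / (c * INR n)).
  { apply Rdiv_lt_0_compat; [apply Rpower_pos | nra]. }
  apply pow_le_reg with k; [lia | | |].
  - pose proof (Rpower_pos (Rpower m p / (c * INR n)) (1 / INR k)). nra.
  - left. now apply (rf_V_pos _ _ _ _ _ _ _ HF).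
  - rewrite Rpow_mult_distr, pow_Rpower_root by (assumption || lia).
    pose proof (flux_ge r Hr) as H. unfold flux in H. rewrite pow_split in H.
    assert (Rpower m p / (c * INR n) <= Rpower (u r) p / (c * INR n)).
    { apply Rmult_le_compat_r; [left; now apply Rinv_0_lt_compat|].
      apply Rpower_le_base; lra. }
    assert (0 < r ^ k) by now apply pow_lt.
    apply Rmult_le_reg_l with (r ^ (n - k)); [now apply pow_lt |].
    eapply Rle_trans; [|exact H].
    assert (0 < r ^ (n - k)) by now apply pow_lt.
    assert (0 < r ^ (n - k) * r ^ k) by nra. nra.
Qed.

(** * Upper bound for [r^alpha u] *)

Let alpha := 2 * INR k / (p - INR k).

Lemma rescaled_upper_bound :
  exists M, 0 < M /\ forall r, 0 < r -> u r * Rpower r alpha <= M.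
Proof.
  set (b := Rpower (/ (c * INR n)) (1 / INR k)).
  (* [(u^(-q))' = q u^(-q-1) V >= q b s], so [u^(-q)] grows at least quadratically; since
     [alpha q = 2], this bounds [(r^alpha u)^q]. *)
  set (q := p / INR k - 1).
  assert (Hcn : 0 < c * INR n) by nra.
  assert (Hb : 0 < b) by apply Rpower_pos.
  assert (Hq : 0 < q).
  { unfold q. assert (1 < p / INR k); [|lra].
    apply Rmult_lt_reg_r with (INR k); [lra|]. unfold Rdiv.
    rewrite Rmult_assoc, Rinv_l; lra. }
  (* Integrating [q b s] over [[r/2, r]] gives [(q b / 2) (r^2 - r^2 / 4)]; starting at [r / 2]
     avoids the endpoint 0. *)
  set (e := 3 / 8 * (q * b)).
  assert (He : 0 < e) by (unfold e; nra).
  assert (HV : forall s, 0 < s -> b * s * Rpower (u s) (p / INR k) <= V s).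
  { intros s Hs. pose proof (rf_u_pos _ _ _ _ _ _ _ HF s Hs) as Hu.
    pose proof (V_ge (u s) s Hs Hu (Rle_refl _)) as H.
    unfold Rdiv at 1 in H.
    rewrite <- Rpower_mult_distr in H; [| apply Rpower_pos | now apply Rinv_0_lt_compat].
    rewrite Rpower_mult in H. replace (p * (1 / INR k)) with (p / INR k) in H by (field; lra).
    fold b in H. lra. }
  assert (Hg : forall r, 0 < r -> e * r ^ 2 <= Rpower (u r) (- q)).
  { intros r Hr.
    assert (H : q * b / 2 * r ^ 2 - Rpower (u r) (- q)
                <= q * b / 2 * (r / 2) ^ 2 - Rpower (u (r / 2)) (- q)).
    { apply derive_nonpos_le with
        (f := fun s => q * b / 2 * s ^ 2 - Rpower (u s) (- q))
        (f' := fun s => q * b * s - - q * Rpower (u s) (- q - 1) * - V s); [lra | |].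
      - intros s Hs. eapply derivable_pt_lim_value.
        + apply derivable_pt_lim_minus.
          * apply derivable_pt_lim_scal, derivable_pt_lim_pow.
          * apply derivable_pt_lim_Rpower_comp.
            -- apply (rf_u_pos _ _ _ _ _ _ _ HF). lra.
            -- apply (rf_u_der _ _ _ _ _ _ _ HF). lra.
        + simpl. field.
      - intros s Hs. specialize (HV s ltac:(lra)).
        assert (Hinv : Rpower (u s) (- q - 1) * Rpower (u s) (p / INR k) = 1).
        { rewrite <- Rpower_plus. replace (- q - 1 + p / INR k) with 0 by (unfold q; ring).
          apply Rpower_O. apply (rf_u_pos _ _ _ _ _ _ _ HF). lra. }
        pose proof (Rpower_pos (u s) (- q - 1)) as Hp.
        apply Rmult_le_compat_l with (r := Rpower (u s) (- q - 1)) in HV; [|lra].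
        replace (Rpower (u s) (- q - 1) * (b * s * Rpower (u s) (p / INR k)))
          with (b * s * (Rpower (u s) (- q - 1) * Rpower (u s) (p / INR k))) in HV by ring.
        rewrite Hinv in HV. nra. }
    pose proof (Rpower_pos (u (r / 2)) (- q)).
    unfold e. nra. }
  (* The exponent [k / (p - k)] is [1 / q]. *)
  exists (Rpower (/ e) (INR k / (p - INR k))). split; [apply Rpower_pos|].
  intros r Hr. specialize (Hg r Hr).
  pose proof (rf_u_pos _ _ _ _ _ _ _ HF r Hr) as Hu.
  set (x := u r * Rpower r alpha).
  assert (Hx : 0 < x) by (apply Rmult_lt_0_compat; [assumption | apply Rpower_pos]).
  assert (Hxq : Rpower x q <= / e).
  { assert (Hprod : Rpower x q * Rpower (u r) (- q) = r ^ 2).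
    { unfold x. rewrite <- Rpower_mult_distr; [| assumption | apply Rpower_pos].
      rewrite Rpower_mult.
      replace (Rpower (u r) q * Rpower r (alpha * q) * Rpower (u r) (- q))
        with (Rpower (u r) q * Rpower (u r) (- q) * Rpower r (alpha * q)) by ring.
      rewrite <- Rpower_plus. replace (q + - q) with 0 by ring.
      rewrite Rpower_O by assumption.
      replace (alpha * q) with (INR 2) by (unfold alpha, q; simpl; field; lra).
      rewrite Rpower_pow by assumption. ring. }
    apply Rmult_le_reg_l with e; [assumption|]. rewrite Rinv_r by lra.
    pose proof (Rpower_pos x q) as Hxp.
    assert (Hr2 : 0 < r ^ 2) by now apply pow_lt.
    apply Rmult_le_compat_l with (r := Rpower x q) in Hg; [|lra].
    rewrite Hprod in Hg. nra. }
  replace x with (Rpower (Rpower x q) (INR k / (p - INR k))).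
  - apply Rpower_le_base; [| apply Rpower_pos | assumption].
    left. apply Rdiv_lt_0_compat; lra.
  - rewrite Rpower_mult. replace (q * (INR k / (p - INR k))) with 1 by (unfold q; field; lra).
    now apply Rpower_1.
Qed.

(** * Emden-Fowler variables, the corrected energy and the lower bound *)

Let beta := INR n - 2 * INR k - alpha * INR k.

Let x (r : R) := u r * Rpower r alpha.
(** The exponent [- beta] makes [Z = (r^(alpha+1) V)^k]. The energy is written through [Z] because
    the flow supplies a derivative for the flux, not for [V]. *)
Let Z (r : R) := Rpower r (- beta) * flux n k V r.
Let z (r : R) := Rpower (Z r) (1 / INR k).

Let alpha_pos : 0 < alpha.
Proof. apply Rdiv_lt_0_compat; lra. Qed.

Let x_pos (r : R) : 0 < r -> 0 < x r.
Proof.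
  intros Hr. apply Rmult_lt_0_compat; [now apply (rf_u_pos _ _ _ _ _ _ _ HF) | apply Rpower_pos].
Qed.

Let Z_eq (r : R) : 0 < r -> Z r = (V r * Rpower r (alpha + 1)) ^ k.
Proof.
  intros Hr. unfold Z, flux. rewrite Rpow_mult_distr.
  rewrite <- (Rpower_pow (n - k) r), <- (Rpower_pow k (Rpower _ _)), Rpower_mult;
    [| apply Rpower_pos | assumption].
  rewrite minus_INR by lia.
  replace ((alpha + 1) * INR k) with (- beta + (INR n - INR k)) by (unfold beta; ring).
  rewrite Rpower_plus. ring.
Qed.

Let z_eq (r : R) : 0 < r -> z r = V r * Rpower r (alpha + 1).
Proof.
  intros Hr. unfold z. rewrite Z_eq by assumption. apply Rpower_pow_root; [lia|].
  apply Rmult_lt_0_compat; [now apply (rf_V_pos _ _ _ _ _ _ _ HF) | apply Rpower_pos].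
Qed.

Let z_pos (r : R) : 0 < r -> 0 < z r.
Proof. intros Hr. apply Rpower_pos. Qed.

Let Z_z (r : R) : 0 < r -> Z r = z r ^ k.
Proof. intros Hr. now rewrite Z_eq, z_eq. Qed.

Let Rpower_mul_id (r a : R) : 0 < r -> Rpower r (a - 1) = Rpower r a / r.
Proof.
  intros Hr. unfold Rminus. rewrite Rpower_plus, Rpower_Ropp, Rpower_1 by assumption. reflexivity.
Qed.

Let x_der (r : R) : 0 < r -> derivable_pt_lim x r ((alpha * x r - z r) / r).
Proof.
  intros Hr. eapply derivable_pt_lim_value.
  - apply derivable_pt_lim_mult.
    + now apply (rf_u_der _ _ _ _ _ _ _ HF).
    + now apply derivable_pt_lim_power.
  - rewrite z_eq, Rpower_mul_id by assumption. unfold x.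
    rewrite Rpower_plus, Rpower_1 by assumption. field. lra.
Qed.

(** [alpha p = n - beta] cancels every explicit power of [r] except the [1/r] coming from
    [d/dr = (1/r) d/d(ln r)]. *)
Let Z_der (r : R) : 0 < r ->
  derivable_pt_lim Z r ((Rpower (x r) p / c - beta * Z r) / r).
Proof.
  intros Hr. eapply derivable_pt_lim_value.
  - apply derivable_pt_lim_mult.
    + now apply derivable_pt_lim_power.
    + now apply (rf_flux_der _ _ _ _ _ _ _ HF).
  - pose proof (rf_u_pos _ _ _ _ _ _ _ HF r Hr) as Hu.
    rewrite Rpower_mul_id by assumption. unfold x, Z.
    rewrite <- Rpower_mult_distr by (assumption || apply Rpower_pos).
    rewrite Rpower_mult.
    replace (alpha * p) with (- beta + INR n) by (unfold beta, alpha; field; lra).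
    rewrite Rpower_plus, (Rpower_pow n r) by assumption.
    replace (r ^ n) with (r * r ^ (n - 1)).
    + field. lra.
    + replace n with (S (n - 1)) at 2 by lia. reflexivity.
Qed.

(** Chosen so that [kappa x^(k+1)] has derivative [(beta - alpha) (alpha x)^k (alpha x - z)] in
    [ln r]. *)
Let kappa := (beta - alpha) * alpha ^ k / INR (k + 1).

(* With [t = ln r], the functions [x] and [Z] solve the autonomous system
   [x' = alpha x - z], [Z' = x^p / c - beta Z], [z = Z^(1/k)].  The first three
   terms are the Pohozaev energy, and the last one makes the derivative
   [(beta - alpha) (alpha x - z) (z^k - (alpha x)^k)] signed when [alpha < beta]. *)
Let E (r : R) :=
  Rpower (x r) (p + 1) / (c * (p + 1)) + INR k / (INR k + 1) * Rpower (Z r) (1 / INR k + 1)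
  - alpha * (x r * Z r) - kappa * x r ^ (k + 1).

Let E_der (r : R) : 0 < r ->
  derivable_pt_lim E r ((beta - alpha) * (alpha * x r - z r) * (z r ^ k - (alpha * x r) ^ k) / r).
Proof.
  intros Hr.
  assert (Hx := x_pos r Hr).
  assert (HZ : 0 < Z r) by (rewrite Z_z by assumption; now apply pow_lt, z_pos).
  eapply derivable_pt_lim_value.
  - apply derivable_pt_lim_minus; [apply derivable_pt_lim_minus; [apply derivable_pt_lim_plus|]|].
    + apply derivable_pt_lim_local_ext
        with (f := fun s => / (c * (p + 1)) * Rpower (x s) (p + 1)) (d := 1);
        [lra | intros; unfold Rdiv; ring |].
      apply derivable_pt_lim_scal, derivable_pt_lim_Rpower_comp; [assumption | now apply x_der].
    + apply derivable_pt_lim_scal, derivable_pt_lim_Rpower_comp; [assumption | now apply Z_der].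
    + apply derivable_pt_lim_scal, derivable_pt_lim_mult; [now apply x_der | now apply Z_der].
    + apply derivable_pt_lim_scal, derivable_pt_lim_pow_comp. now apply x_der.
  - replace (p + 1 - 1) with p by ring. replace (1 / INR k + 1 - 1) with (1 / INR k) by ring.
    fold (z r). replace (pred (k + 1)) with k by lia.
    rewrite Z_z by assumption. unfold kappa. rewrite plus_INR, Rpow_mult_distr. simpl (INR 1).
    field. lra.
Qed.

Let E_decr (a b : R) : alpha < beta -> 0 < a -> a <= b -> E b <= E a.
Proof.
  intros Hab Ha Hle. eapply derive_nonpos_le; [assumption | |].
  - intros s Hs. apply E_der. lra.
  - intros s Hs. cbv beta.
    assert (Hs0 : 0 < s) by lra.
    pose proof (x_pos s Hs0). pose proof (z_pos s Hs0).
    (* [y^k] is increasing in [y > 0], so the two factors have opposite signs. *)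
    assert (H1 : (alpha * x s - z s) * (z s ^ k - (alpha * x s) ^ k) <= 0).
    { assert (0 < alpha * x s) by nra.
      destruct (Rle_lt_dec (z s) (alpha * x s)).
      - assert (z s ^ k <= (alpha * x s) ^ k) by (apply pow_incr; lra). nra.
      - assert ((alpha * x s) ^ k <= z s ^ k) by (apply pow_incr; lra). nra. }
    assert (0 < / s) by now apply Rinv_0_lt_compat.
    unfold Rdiv. rewrite Rmult_assoc with (r1 := beta - alpha).
    assert (0 < (beta - alpha) * / s) by nra. nra.
Qed.

(** The ratio [z / x] at which [k/(k+1) z^(k+1)] and [alpha x z^k] balance. *)
Let tau := alpha * (INR k + 1) / INR k.

Let tau_pos : 0 < tau.
Proof. unfold tau. apply Rdiv_lt_0_compat; nra. Qed.

Let E_eq (r : R) : 0 < r ->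
  E r = Rpower (x r) (p + 1) / (c * (p + 1))
        + INR k / (INR k + 1) * (z r - tau * x r) * z r ^ k - kappa * x r ^ (k + 1).
Proof.
  intros Hr. unfold E. rewrite (Rpower_plus (1 / INR k)), (Rpower_1 (Z r)).
  - fold (z r). rewrite Z_z by assumption. unfold tau. field.
    repeat split; lra.
  - rewrite Z_z by assumption. now apply pow_lt, z_pos.
Qed.

(** As [r -> 0], [z / x = r V / u = O(r^2)] and [x^(p-k) = u^(p-k) r^(2k) -> 0], so
    [- kappa x^(k+1)] dominates the energy. *)
Let E_neg : alpha < beta -> exists r, 0 < r /\ E r < 0.
Proof.
  intros Hab.
  assert (Hkap : 0 < kappa).
  { apply Rdiv_lt_0_compat; [| apply lt_0_INR; lia].
    apply Rmult_lt_0_compat; [lra | now apply pow_lt]. }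
  set (A := Rpower (Rpower rho p / (c * INR n)) (1 / INR k)).
  assert (HA : 0 < A) by apply Rpower_pos.
  pose proof (rf_u_pos _ _ _ _ _ _ _ HF 1 ltac:(lra)) as Hu1.
  set (B := Rpower rho (p - INR k)).
  assert (HB : 0 < B) by apply Rpower_pos.
  assert (Hcp : 0 < kappa * (c * (p + 1))) by (assert (0 < c * (p + 1)) by nra; nra).
  (* [r <= 1] gives [u r >= u 1] and bounds [r^2] and [r^(2k)] by [r]. The second entry forces
     [z <= tau x]; the third, with a factor 2 for strictness, makes the [x^(p+1)] term smaller than
     [kappa x^(k+1)]. *)
  set (r := Rmin 1 (Rmin (tau * u 1 / A) (kappa * (c * (p + 1)) / (2 * B)))).
  assert (Hr : 0 < r).
  { repeat apply Rmin_pos; [lra | |]; apply Rdiv_lt_0_compat; nra. }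
  assert (Hr1 : r <= 1) by apply Rmin_l.
  assert (Hr2 : r * A <= tau * u 1).
  { replace (tau * u 1) with (tau * u 1 / A * A) by (field; lra).
    apply Rmult_le_compat_r; [lra|]. eapply Rle_trans; [apply Rmin_r | apply Rmin_l]. }
  assert (Hr3 : r * B < kappa * (c * (p + 1))).
  { assert (r * (2 * B) <= kappa * (c * (p + 1))); [|nra].
    replace (kappa * (c * (p + 1))) with (kappa * (c * (p + 1)) / (2 * B) * (2 * B))
      by (field; lra).
    apply Rmult_le_compat_r; [lra|]. eapply Rle_trans; [apply Rmin_r | apply Rmin_r]. }
  exists r. split; [assumption|]. rewrite E_eq by assumption.
  pose proof (x_pos r Hr) as Hx. pose proof (z_pos r Hr) as Hz.
  pose proof (rf_u_pos _ _ _ _ _ _ _ HF r Hr) as Hu.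
  assert (Hzx : z r <= tau * x r).
  { rewrite z_eq, Rpower_plus, Rpower_1 by assumption. unfold x.
    pose proof (Rpower_pos r alpha). pose proof (V_le r Hr) as HV. fold A in HV.
    pose proof (flow_u_decr r 1 Hr Hr1).
    assert (V r * r <= tau * u r).
    { pose proof (rf_V_pos _ _ _ _ _ _ _ HF r Hr). nra. }
    nra. }
  assert (Hxp : Rpower (x r) (p + 1) / (c * (p + 1)) < kappa * x r ^ (k + 1)).
  { assert (0 < c * (p + 1)) by nra.
    apply Rmult_lt_reg_r with (c * (p + 1)); [assumption|].
    unfold Rdiv. rewrite Rmult_assoc, Rinv_l, Rmult_1_r by lra.
    replace (p + 1) with (p - INR k + INR (k + 1)) at 1 by (rewrite plus_INR; simpl (INR 1); ring).
    rewrite Rpower_plus, Rpower_pow by assumption.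
    assert (0 < x r ^ (k + 1)) by now apply pow_lt.
    assert (Rpower (x r) (p - INR k) <= r * B).
    { unfold x. rewrite <- Rpower_mult_distr by (assumption || apply Rpower_pos).
      rewrite Rpower_mult.
      replace (alpha * (p - INR k)) with (INR (2 * k))
        by (rewrite mult_INR; simpl (INR 2); unfold alpha; field; lra).
      rewrite Rpower_pow by assumption.
      assert (r ^ (2 * k) <= r).
      { replace (2 * k)%nat with (S (2 * k - 1)) by lia. simpl.
        assert (0 < r ^ (k + (k + 0) - 1)) by now apply pow_lt.
        assert (r ^ (k + (k + 0) - 1) <= 1 ^ (k + (k + 0) - 1)) by (apply pow_incr; lra).
        rewrite pow1 in *. nra. }
      assert (Rpower (u r) (p - INR k) <= B).
      { apply Rpower_le_base; [lra | assumption | now apply flow_u_le]. }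
      pose proof (Rpower_pos (u r) (p - INR k)).
      assert (0 < r ^ (2 * k)) by now apply pow_lt. nra. }
    nra. }
  assert (0 < INR k / (INR k + 1)) by (apply Rdiv_lt_0_compat; lra).
  assert (0 < z r ^ k) by now apply pow_lt.
  assert (0 < INR k / (INR k + 1) * z r ^ k) by nra.
  nra.
Qed.

Lemma rescaled_lower_bound :
  (INR n + 2) * INR k / (INR n - 2 * INR k) < p ->
  exists m r0, 0 < m /\ 0 < r0 /\ forall r, r0 <= r -> m <= u r * Rpower r alpha.
Proof.
  intros Hso.
  assert (Hnk : 0 < INR n - 2 * INR k).
  { apply lt_INR in Hkn. rewrite mult_INR in Hkn. simpl (INR 2) in Hkn. lra. }
  (* [alpha < beta] amounts to [2k (k+1) < (n - 2k) (p - k)], a rearrangement of [Hso]. *)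
  assert (Hab : alpha < beta).
  { apply Rmult_lt_compat_r with (r := INR n - 2 * INR k) in Hso; [|assumption].
    unfold Rdiv in Hso. rewrite Rmult_assoc, Rinv_l, Rmult_1_r in Hso by lra.
    unfold beta. assert (alpha * (INR k + 1) < INR n - 2 * INR k); [|lra].
    unfold alpha. apply Rmult_lt_reg_r with (p - INR k); [lra|].
    replace (2 * INR k / (p - INR k) * (INR k + 1) * (p - INR k))
      with (2 * INR k * (INR k + 1)) by (field; lra).
    nra. }
  destruct (E_neg Hab) as [r0 [Hr0 HE0]].
  (* If [z < tau x], the negative part [alpha x z^k] is at most [alpha tau^k x^(k+1)]; if
     [z >= tau x], the middle term of the energy is nonnegative. *)
  set (D := alpha * tau ^ k + kappa).
  assert (Hkap : 0 < kappa).
  { apply Rdiv_lt_0_compat; [| apply lt_0_INR; lia].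
    apply Rmult_lt_0_compat; [lra | now apply pow_lt]. }
  assert (Htk : 0 < tau ^ k) by now apply pow_lt.
  assert (HD : 0 < D) by (unfold D; nra).
  (* When [x < 1], [x^(k+1) <= x] turns [D x^(k+1) >= - E r0] into a linear bound. *)
  exists (Rmin 1 (- E r0 / D)), r0.
  split; [apply Rmin_pos; [lra | apply Rdiv_lt_0_compat; lra]|].
  split; [assumption|]. intros r Hr.
  assert (Hrp : 0 < r) by lra.
  change (u r * Rpower r alpha) with (x r).
  pose proof (x_pos r Hrp) as Hx. pose proof (z_pos r Hrp) as Hz.
  assert (HE : E r <= E r0) by (apply E_decr; assumption).
  assert (HDx : - E r0 <= D * x r ^ (k + 1)).
  { eapply Rle_trans; [apply Ropp_le_contravar, HE|].
    rewrite E_eq by assumption.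
    assert (0 < Rpower (x r) (p + 1) / (c * (p + 1)))
      by (apply Rdiv_lt_0_compat; [apply Rpower_pos | nra]).
    assert (0 < INR k / (INR k + 1)) by (apply Rdiv_lt_0_compat; lra).
    assert (0 < z r ^ k) by now apply pow_lt.
    assert (0 < x r ^ (k + 1)) by now apply pow_lt.
    assert (0 < INR k / (INR k + 1) * z r ^ k) by nra.
    unfold D. destruct (Rle_lt_dec (tau * x r) (z r)) as [Hle|Hlt].
    - assert (0 < alpha * tau ^ k * x r ^ (k + 1)) by (apply Rmult_lt_0_compat; nra). nra.
    - assert (Hzk : z r ^ k <= tau ^ k * x r ^ k).
      { rewrite <- Rpow_mult_distr. apply pow_incr. lra. }
      assert (INR k / (INR k + 1) * (tau * x r) * z r ^ k <= alpha * tau ^ k * x r ^ (k + 1)).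
      { replace (INR k / (INR k + 1) * (tau * x r)) with (alpha * x r) by (unfold tau; field; lra).
        rewrite pow_add, pow_1.
        replace (alpha * tau ^ k * (x r ^ k * x r)) with (alpha * x r * (tau ^ k * x r ^ k)) by ring.
        apply Rmult_le_compat_l; nra. }
      nra. }
  destruct (Rle_lt_dec 1 (x r)) as [H1|H1].
  - eapply Rle_trans; [apply Rmin_l | assumption].
  - eapply Rle_trans; [apply Rmin_r|].
    assert (x r ^ (k + 1) <= x r).
    { rewrite pow_add, pow_1.
      assert (x r ^ k <= 1 ^ k) by (apply pow_incr; lra).
      rewrite pow1 in *. nra. }
    apply Rmult_le_reg_r with D; [assumption|].
    unfold Rdiv. rewrite Rmult_assoc, Rinv_l, Rmult_1_r by lra. nra.
Qed.

End OneFlow.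

(** * Uniqueness from the singular point, and scaling invariance *)

(* With [e = (W1 - W2) / r^(n-1)], [W] being the flux, the system for
   [(u1 - u2, e)] is Lipschitz up to the term [- (n-1) e / r], which has the
   favourable sign; so a Gronwall estimate holds up to the singular point 0. *)
Lemma radial_flow_unique (rho : R) (u1 V1 u2 V2 : R -> R) (r : R) :
  radial_flow n k p c rho u1 V1 -> radial_flow n k p c rho u2 V2 ->
  0 < r -> u1 r = u2 r.
Proof.
  intros H1 H2 Hr.
  assert (Hcn : 0 < c * INR n) by nra.
  pose proof (flow_rho_pos _ _ _ H1) as Hrho.
  pose proof (rf_u_pos _ _ _ _ _ _ _ H1 r Hr) as Hu1.
  pose proof (rf_u_pos _ _ _ _ _ _ _ H2 r Hr) as Hu2.
  (* Both solutions decrease, so [m] bounds them below on [(0, r]], and both [V1 s] and [V2 s] are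
     at least [a s] there. *)
  set (m := Rmin (u1 r) (u2 r)).
  assert (Hm : 0 < m) by now apply Rmin_pos.
  set (a := Rpower (Rpower m p / (c * INR n)) (1 / INR k)).
  assert (Ha : 0 < a) by apply Rpower_pos.
  set (A := Rpower rho p / (c * INR n)).
  set (K := p * Rpower rho (p - 1)).
  assert (HK : 0 < K) by (apply Rmult_lt_0_compat; [lra | apply Rpower_pos]).
  set (K' := / a ^ (k - 1)).
  assert (Hak : 0 < a ^ (k - 1)) by now apply pow_lt.
  assert (HK' : 0 < K') by now apply Rinv_0_lt_compat.
  set (L := K' + K / c).
  assert (HKc : 0 < K / c) by now apply Rdiv_lt_0_compat.
  set (f := fun s => u1 s - u2 s).
  set (d := fun s => flux n k V1 s - flux n k V2 s).
  set (e := fun s => d s / s ^ (n - 1)).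
  set (g := fun s => (Rpower (u1 s) p - Rpower (u2 s) p) / c).
  assert (Hf : forall s, 0 < s -> derivable_pt_lim f s (- (V1 s - V2 s))).
  { intros s Hs. replace (- (V1 s - V2 s)) with (- V1 s - - V2 s) by ring.
    apply derivable_pt_lim_minus; eapply rf_u_der; eassumption. }
  assert (He : forall s, 0 < s ->
            derivable_pt_lim e s (g s - INR (n - 1) * e s / s)).
  { intros s Hs. eapply derivable_pt_lim_value.
    - apply derivable_pt_lim_div_pow; [assumption|].
      apply derivable_pt_lim_minus; eapply rf_flux_der; eassumption.
    - unfold g, e, d. field. assert (0 < s ^ (n - 1)) by now apply pow_lt. lra. }
  assert (Hms : forall s, 0 < s <= r -> m <= u1 s /\ m <= u2 s).
  { intros s Hs. split.
    - eapply Rle_trans; [apply Rmin_l | eapply flow_u_decr; try eassumption; lra].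
    - eapply Rle_trans; [apply Rmin_r | eapply flow_u_decr; try eassumption; lra]. }
  (* Here [e = (V1^k - V2^k) / s^(k-1)]: the lower bound [a s] on [V1] and [V2] exactly absorbs the
     weight [s^(k-1)], leaving the constant [K']. This dictates the division of the flux by
     [r^(n-1)]. *)
  assert (HfV : forall s, 0 < s <= r -> Rabs (V1 s - V2 s) <= K' * Rabs (e s)).
  { intros s Hs. destruct (Hms s Hs) as [Hm1 Hm2].
    pose proof (V_ge _ _ _ H1 m s ltac:(lra) Hm Hm1) as HV1.
    pose proof (V_ge _ _ _ H2 m s ltac:(lra) Hm Hm2) as HV2.
    fold a in HV1, HV2.
    pose proof (pow_sub_ge (k - 1) (a * s) (V1 s) (V2 s) ltac:(nra) HV1 HV2) as Hp.
    replace (S (k - 1)) with k in Hp by lia.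
    assert (Hs0 : 0 < s) by lra.
    assert (Hsk : 0 < s ^ (k - 1)) by now apply pow_lt.
    assert (Hsnk : 0 < s ^ (n - k)) by now apply pow_lt.
    assert (He' : e s = (V1 s ^ k - V2 s ^ k) / s ^ (k - 1)).
    { unfold e, d, flux. replace (n - 1)%nat with ((n - k) + (k - 1))%nat by lia.
      rewrite pow_add. field. lra. }
    rewrite He', Rabs_div_pos by lra.
    rewrite Rpow_mult_distr in Hp.
    apply Rmult_le_reg_r with (a ^ (k - 1) * s ^ (k - 1)); [nra|].
    replace (K' * (Rabs (V1 s ^ k - V2 s ^ k) / s ^ (k - 1)) * (a ^ (k - 1) * s ^ (k - 1)))
      with (Rabs (V1 s ^ k - V2 s ^ k)) by (unfold K'; field; lra).
    assumption. }
  assert (Hg : forall s, 0 < s <= r -> Rabs (g s) <= K / c * Rabs (f s)).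
  { assert (Hord : forall x y, 0 < y <= x -> x <= rho ->
              Rabs (Rpower x p - Rpower y p) <= K * Rabs (x - y)).
    { intros x y [Hy Hyx] Hx.
      destruct (Req_dec x y) as [->|Hne].
      { rewrite !Rminus_diag, Rabs_R0. lra. }
      destruct (MVT_cor2 (fun t => Rpower t p) (fun t => p * Rpower t (p - 1)) y x)
        as [t [Ht1 Ht2]].
      - lra.
      - intros t Ht. apply derivable_pt_lim_power. lra.
      - rewrite Ht1, Rabs_mult. apply Rmult_le_compat_r; [apply Rabs_pos|].
        pose proof (Rpower_pos t (p - 1)).
        rewrite Rabs_pos_eq by nra. unfold K. apply Rmult_le_compat_l; [lra|].
        apply Rpower_le_base; lra. }
    intros s Hs. unfold g, f. rewrite Rabs_div_pos by lra.
    replace (K / c * Rabs (u1 s - u2 s)) with (K * Rabs (u1 s - u2 s) / c) by (field; lra).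
    apply Rmult_le_compat_r; [left; now apply Rinv_0_lt_compat|].
    pose proof (rf_u_pos _ _ _ _ _ _ _ H1 s ltac:(lra)).
    pose proof (rf_u_pos _ _ _ _ _ _ _ H2 s ltac:(lra)).
    pose proof (flow_u_le _ _ _ H1 s ltac:(lra)).
    pose proof (flow_u_le _ _ _ H2 s ltac:(lra)).
    destruct (Rle_lt_dec (u2 s) (u1 s)).
    - apply Hord; lra.
    - rewrite Rabs_minus_sym, (Rabs_minus_sym (u1 s)). apply Hord; lra. }
  set (S := fun s => f s ^ 2 + e s ^ 2).
  set (S' := fun s => 2 * f s * - (V1 s - V2 s) + 2 * e s * (g s - INR (n - 1) * e s / s)).
  assert (HS : forall s, 0 < s -> derivable_pt_lim S s (S' s)).
  { intros s Hs. eapply derivable_pt_lim_value.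
    - apply derivable_pt_lim_plus; apply derivable_pt_lim_pow_comp; [now apply Hf | now apply He].
    - unfold S'. simpl. ring. }
  assert (HSS : forall s, 0 < s <= r -> S' s <= L * S s).
  { intros s Hs. unfold S', S.
    specialize (HfV s Hs). specialize (Hg s Hs).
    assert (Hdamp : 0 <= INR (n - 1) * e s ^ 2 / s).
    { apply Rmult_le_pos; [| left; apply Rinv_0_lt_compat; lra].
      apply Rmult_le_pos; [apply pos_INR | apply pow2_ge_0]. }
    replace (2 * e s * (g s - INR (n - 1) * e s / s))
      with (2 * (e s * g s) - 2 * (INR (n - 1) * e s ^ 2 / s)) by (field; lra).
    assert (Ha1 : f s * - (V1 s - V2 s) <= K' * (Rabs (f s) * Rabs (e s))).
    { eapply Rle_trans; [apply Rle_abs|]. rewrite Rabs_mult, Rabs_Ropp.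
      pose proof (Rabs_pos (f s)). nra. }
    assert (Ha2 : e s * g s <= K / c * (Rabs (f s) * Rabs (e s))).
    { eapply Rle_trans; [apply Rle_abs|]. rewrite Rabs_mult.
      pose proof (Rabs_pos (e s)). nra. }
    rewrite <- (pow2_abs (e s)) in Hdamp |- *. rewrite <- (pow2_abs (f s)).
    pose proof (pow2_ge_0 (Rabs (f s) - Rabs (e s))) as Hsq.
    assert (0 < L) by (unfold L; lra).
    assert (L * (2 * (Rabs (f s) * Rabs (e s))) <= L * (Rabs (f s) ^ 2 + Rabs (e s) ^ 2))
      by (apply Rmult_le_compat_l; lra).
    unfold L in *. lra. }
  (* [u1] and [u2] share the limit [rho], and the flux bound [A s^n] gives [e = O(s)]. With
     [eta <= 1], [|f| < eta] implies [f^2 < eta]. *)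
  assert (HS0 : rlim0 S 0).
  { intros eps Heps.
    set (eta := Rmin 1 (eps / 2)).
    assert (Heta : 0 < eta) by (apply Rmin_pos; lra).
    assert (Heta1 : eta <= 1) by apply Rmin_l.
    assert (Heta2 : eta <= eps / 2) by apply Rmin_r.
    destruct (rf_u_lim _ _ _ _ _ _ _ H1 (eta / 2)) as [d1 [Hd1 Hl1]]; [lra|].
    destruct (rf_u_lim _ _ _ _ _ _ _ H2 (eta / 2)) as [d2 [Hd2 Hl2]]; [lra|].
    destruct (rlim0_linear_bound e 0 A 1 ltac:(lra)) with eta as [d3 [Hd3 Hl3]]; [| lra |].
    { intros s Hs. rewrite Rminus_0_r. unfold e.
      assert (Hsn : 0 < s ^ (n - 1)) by (apply pow_lt; lra).
      rewrite Rabs_div_pos by lra.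
      apply Rmult_le_reg_r with (s ^ (n - 1)); [assumption|].
      unfold Rdiv. rewrite Rmult_assoc, Rinv_l, Rmult_1_r by lra.
      assert (Hsn' : s ^ n = s * s ^ (n - 1)).
      { replace n with (Datatypes.S (n - 1)) at 1 by lia. reflexivity. }
      rewrite Rmult_assoc, <- Hsn'. unfold d.
      pose proof (flux_le _ _ _ H1 s ltac:(lra)) as Hb1.
      pose proof (flux_le _ _ _ H2 s ltac:(lra)) as Hb2.
      fold A in Hb1, Hb2.
      assert (Hp : forall V u, radial_flow n k p c rho u V -> 0 < flux n k V s).
      { intros V u HV. unfold flux. apply Rmult_lt_0_compat; apply pow_lt; [lra|].
        eapply rf_V_pos; [eassumption | lra]. }
      pose proof (Hp _ _ H1). pose proof (Hp _ _ H2).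
      apply Rabs_le. lra. }
    exists (Rmin d1 (Rmin d2 d3)). split; [repeat apply Rmin_pos; assumption|].
    intros s Hs.
    pose proof (Rmin_l d1 (Rmin d2 d3)). pose proof (Rmin_r d1 (Rmin d2 d3)).
    pose proof (Rmin_l d2 d3). pose proof (Rmin_r d2 d3).
    specialize (Hl1 s ltac:(lra)). specialize (Hl2 s ltac:(lra)). specialize (Hl3 s ltac:(lra)).
    apply Rabs_def2 in Hl1, Hl2, Hl3.
    assert (- eta < f s < eta) by (unfold f; lra).
    assert (f s ^ 2 < eta) by (simpl; nra).
    assert (e s ^ 2 < eta) by (simpl; nra).
    unfold S. pose proof (pow2_ge_0 (f s)). pose proof (pow2_ge_0 (e s)).
    apply Rabs_def1; lra. }
  (* [S' <= L S] makes [S exp(- L s)] nonincreasing, with limit 0 at 0. *)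
  assert (HSr : S r * exp (- L * r) <= 0).
  { apply derive_nonpos_rlim0 with
      (f := fun s => S s * exp (- L * s))
      (f' := fun s => S' s * exp (- L * s) + S s * (- L * exp (- L * s))); [assumption | | |].
    - intros eps Heps. destruct (HS0 eps Heps) as [d0 [Hd0 Hlim]].
      exists d0. split; [assumption|]. intros s Hs. specialize (Hlim s Hs).
      rewrite Rminus_0_r in *. rewrite Rabs_mult, (Rabs_pos_eq (exp _)) by (left; apply exp_pos).
      assert (exp (- L * s) <= 1).
      { rewrite <- exp_0. assert (0 < L) by (unfold L; lra).
        left. apply exp_increasing. nra. }
      pose proof (exp_pos (- L * s)). pose proof (Rabs_pos (S s)). nra.
    - intros s Hs. apply (derivable_pt_lim_mult S (fun s => exp (- L * s))); [apply HS; lra|].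
      apply (derivable_pt_lim_scale_arg exp (- L) s (exp (- L * s))), derivable_pt_lim_exp.
    - intros s Hs. specialize (HSS s ltac:(lra)). pose proof (exp_pos (- L * s)). nra. }
  pose proof (exp_pos (- L * r)).
  assert (S r <= 0) by nra.
  pose proof (pow2_ge_0 (f r)). pose proof (pow2_ge_0 (e r)).
  unfold S in *. assert (f r ^ 2 = 0) by lra.
  assert (f r = 0) by (apply Rsqr_0_uniq; unfold Rsqr; simpl in *; lra).
  unfold f in *. lra.
Qed.

(** The two sides of the flux equation scale alike when [lam^p = lam^k mu^(2k)], which determines
    [lam]. *)
Lemma radial_flow_scale (mu rho : R) (u V : R -> R) :
  0 < mu -> radial_flow n k p c rho u V ->
  let lam := Rpower mu (2 * INR k / (p - INR k)) in
  radial_flow n k p c (lam * rho) (fun r => lam * u (mu * r)) (fun r => lam * mu * V (mu * r)).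
Proof.
  intros Hmu HF lam.
  assert (Hlam : 0 < lam) by apply Rpower_pos.
  assert (Hflux : forall s, flux n k (fun r => lam * mu * V (mu * r)) s
            = lam ^ k * mu ^ k / mu ^ (n - k) * flux n k V (mu * s)).
  { intros s. unfold flux. rewrite !Rpow_mult_distr. field.
    assert (0 < mu ^ (n - k)) by now apply pow_lt. lra. }
  assert (Hmurlim : forall f l a, 0 < a -> rlim0 f l -> rlim0 (fun r => a * f (mu * r)) (a * l)).
  { intros f l a Ha Hl eps Heps.
    destruct (Hl (eps / a)) as [d [Hd Hs]]; [now apply Rdiv_lt_0_compat|].
    exists (d / mu). split; [now apply Rdiv_lt_0_compat|]. intros s Hs'.
    replace (a * f (mu * s) - a * l) with (a * (f (mu * s) - l)) by ring.
    rewrite Rabs_mult, (Rabs_pos_eq a) by lra.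
    replace eps with (a * (eps / a)) by (field; lra).
    apply Rmult_lt_compat_l; [assumption|]. apply Hs.
    split; [nra|]. replace d with (mu * (d / mu)) by (field; lra).
    apply Rmult_lt_compat_l; lra. }
  split.
  - intros r Hr. apply Rmult_lt_0_compat; [assumption|].
    apply (rf_u_pos _ _ _ _ _ _ _ HF). nra.
  - intros r Hr. apply Rmult_lt_0_compat; [nra|].
    apply (rf_V_pos _ _ _ _ _ _ _ HF). nra.
  - intros r Hr. replace (- (lam * mu * V (mu * r))) with (lam * (mu * - V (mu * r))) by ring.
    apply derivable_pt_lim_scal, derivable_pt_lim_scale_arg.
    apply (rf_u_der _ _ _ _ _ _ _ HF). nra.
  - intros r Hr.
    apply derivable_pt_lim_local_ext
      with (f := fun s => lam ^ k * mu ^ k / mu ^ (n - k) * flux n k V (mu * s)) (d := 1);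
      [lra | intros; now rewrite Hflux |].
    assert (Hmr : 0 < mu * r) by nra.
    eapply derivable_pt_lim_value.
    + apply derivable_pt_lim_scal, derivable_pt_lim_scale_arg.
      apply (rf_flux_der _ _ _ _ _ _ _ HF). assumption.
    + pose proof (rf_u_pos _ _ _ _ _ _ _ HF _ Hmr).
      rewrite <- Rpower_mult_distr by assumption.
      assert (Hlp : Rpower lam p = lam ^ k * (mu ^ k * mu ^ k)).
      { rewrite <- pow_add, <- !Rpower_pow by assumption. unfold lam.
        rewrite !Rpower_mult, <- Rpower_plus, plus_INR. f_equal. field. lra. }
      rewrite Hlp, Rpow_mult_distr.
      replace (mu ^ (n - 1)) with (mu ^ (n - k) * mu ^ k / mu).
      * assert (0 < mu ^ (n - k)) by now apply pow_lt. field. lra.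
      * rewrite <- pow_add. replace (n - k + k)%nat with (S (n - 1)) by lia.
        simpl. field. lra.
  - apply (Hmurlim u rho lam Hlam), (rf_u_lim _ _ _ _ _ _ _ HF).
  - intros eps Heps.
    set (a := lam ^ k * mu ^ k / mu ^ (n - k)) in *.
    assert (Ha : 0 < a).
    { apply Rdiv_lt_0_compat; [apply Rmult_lt_0_compat|]; now apply pow_lt. }
    destruct (Hmurlim _ 0 a Ha (rf_flux_lim _ _ _ _ _ _ _ HF) eps Heps) as [d [Hd Hs]].
    exists d. split; [assumption|]. intros s Hs'. rewrite Hflux.
    specialize (Hs s Hs'). now rewrite Rmult_0_r in Hs.
Qed.

End Flow.

(** * From regular solutions to the flow *)

Lemma sqsum_axis (m : nat) (t : R) : sqsum (S m) (update (fun _ => 0) 0 t) = t ^ 2.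
Proof.
  induction m as [|m IH]; [simpl; unfold update; simpl; ring|].
  change (sqsum (S m) (update (fun _ => 0) 0 t) + update (fun _ => 0) 0 t (S m) ^ 2 = t ^ 2).
  rewrite IH. unfold update. simpl. ring.
Qed.

Lemma sqsum_ext (m : nat) (x y : nat -> R) : (forall i, x i = y i) -> sqsum m x = sqsum m y.
Proof. intros H. induction m as [|m IH]; simpl; [reflexivity|]. now rewrite IH, H. Qed.

Lemma radial_axis (n : nat) (u : R -> R) (t : R) :
  (0 < n)%nat -> 0 <= t -> radial n u (update (fun _ => 0) 0 t) = u t.
Proof.
  intros Hn Ht. unfold radial. destruct n as [|n]; [lia|].
  rewrite sqsum_axis, sqrt_pow2 by assumption. reflexivity.
Qed.

(** On the positive first axis [u'] is the first partial derivative of the radial function, which is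
    continuous at the origin. *)
Lemma C2_radial_derivative_bounded (n : nat) (u du : R -> R) :
  (0 < n)%nat -> C2_Rn n (radial n u) -> (forall r, 0 < r -> derivable_pt_lim u r (du r)) ->
  exists B d, 0 < d /\ forall r, 0 < r < d -> Rabs (du r) <= B.
Proof.
  intros Hn [D1 [D2 [_ [HD1 [_ [HC1 _]]]]]] Hdu.
  destruct (HC1 0%nat Hn (fun _ => 0) 1 ltac:(lra)) as [d [Hd Hcont]].
  exists (Rabs (D1 0%nat (fun _ => 0)) + 1), d. split; [assumption|].
  intros r Hr.
  set (y := update (fun _ => 0) 0 r).
  assert (Hy : y 0%nat = r) by reflexivity.
  assert (Heq : du r = D1 0%nat y).
  { apply uniqueness_limite with u r; [apply Hdu; lra|].
    pose proof (HD1 0%nat y Hn) as H. unfold is_partial in H. rewrite Hy in H.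
    eapply derivable_pt_lim_local_ext with (d := r); [lra | | exact H].
    intros s Hs. apply Rabs_def2 in Hs. cbv beta.
    rewrite <- (radial_axis n u s) by (lia || lra).
    unfold radial. do 2 f_equal. apply sqsum_ext. intros i.
    unfold y, update. destruct (Nat.eqb i 0); reflexivity. }
  rewrite Heq.
  assert (Hclose : Rabs (D1 0%nat y - D1 0%nat (fun _ => 0)) < 1).
  { apply Hcont. rewrite sqsum_ext with (y := y) by (intros; ring).
    unfold y. destruct n as [|n]; [lia|]. rewrite sqsum_axis. simpl. nra. }
  pose proof (Rabs_triang (D1 0%nat y - D1 0%nat (fun _ => 0)) (D1 0%nat (fun _ => 0))) as Ht.
  replace (D1 0%nat y - D1 0%nat (fun _ => 0) + D1 0%nat (fun _ => 0)) with (D1 0%nat y) in Ht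
    by ring.
  lra.
Qed.

Lemma C_pos (a b : nat) : 0 < C a b.
Proof.
  unfold C. apply Rdiv_lt_0_compat; [apply INR_fact_lt_0|].
  apply Rmult_lt_0_compat; apply INR_fact_lt_0.
Qed.

(** No sign of [u'] is given in advance: [w = r^(n-k) |u'|^(k-1) u'] strictly decreases from the
    limit 0, and a negative [w] forces [u' < 0]. *)
Lemma regular_solution_flow (n k : nat) (p rho : R) (u : R -> R) :
  (1 < k)%nat -> (2 * k < n)%nat -> regular_solution16 n k p rho u ->
  exists V, radial_flow n k p (1 / INR k * C (n - 1) (k - 1)) rho u V.
Proof.
  intros Hk Hkn [[Hu0 [Hupos [Hright [du [Hdu Heq]]]]] HC2].
  set (c := 1 / INR k * C (n - 1) (k - 1)).
  assert (Hc : 0 < c).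
  { apply Rmult_lt_0_compat; [| apply C_pos]. apply Rdiv_lt_0_compat; [lra|].
    apply lt_0_INR. lia. }
  set (w := fun s => s ^ (n - k) * Rabs (du s) ^ (k - 1) * du s) in *.
  assert (Hw : forall r, 0 < r -> derivable_pt_lim w r (- (r ^ (n - 1) * Rpower (u r) p / c))).
  { intros r Hr. destruct (Heq r Hr) as [L [HL1 HL2]].
    eapply derivable_pt_lim_value; [exact HL1|]. rewrite <- HL2.
    replace (- (1 / INR k) * C (n - 1) (k - 1) * L) with (- c * L) by (unfold c; ring).
    field. lra. }
  assert (Hwneg' : forall r, 0 < r -> - (r ^ (n - 1) * Rpower (u r) p / c) < 0).
  { intros r Hr. apply Ropp_lt_gt_0_contravar. apply Rdiv_lt_0_compat; [|assumption].
    apply Rmult_lt_0_compat; [now apply pow_lt | apply Rpower_pos]. }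
  assert (Hwlim : rlim0 w 0).
  (* [|w| = s^(n-k) |u'|^k <= B^k s] for small [s < 1], since [n - k >= 1]. *)
  { destruct (C2_radial_derivative_bounded n u du ltac:(lia) HC2 Hdu) as [B [d [Hd HB]]].
    apply rlim0_linear_bound with (B ^ k) (Rmin 1 d); [apply Rmin_pos; lra|].
    intros s Hs. pose proof (Rmin_l 1 d). pose proof (Rmin_r 1 d).
    specialize (HB s ltac:(lra)). rewrite Rminus_0_r. unfold w.
    rewrite Rmult_assoc, Rabs_mult, (Rabs_mult (_ ^ _)), RPow_abs, Rabs_Rabsolu.
    rewrite <- (RPow_abs (du s)), (Rmult_comm (_ ^ (k - 1))).
    change (Rabs (du s) * Rabs (du s) ^ (k - 1)) with (Rabs (du s) ^ (S (k - 1))).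
    replace (S (k - 1)) with k by lia.
    assert (Rabs (du s) ^ k <= B ^ k) by (apply pow_incr; split; [apply Rabs_pos | assumption]).
    assert (0 <= Rabs (du s) ^ k) by (apply pow_le, Rabs_pos).
    assert (Hsn : 0 < s ^ (n - k) <= s).
    { replace (n - k)%nat with (S (n - k - 1)) by lia. simpl.
      assert (0 < s ^ (n - k - 1)) by (apply pow_lt; lra).
      assert (s ^ (n - k - 1) <= 1 ^ (n - k - 1)) by (apply pow_incr; lra).
      rewrite pow1 in *. nra. }
    rewrite (Rabs_pos_eq (s ^ (n - k))) by lra. nra. }
  assert (Hwneg : forall r, 0 < r -> w r < 0).
  { intros r Hr.
    (* The limit yields only [w <= 0]; the negative derivative over [[r/2, r]] then makes the
       inequality strict at [r]. *)
    assert (H1 : w (r / 2) <= 0).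
    { eapply derive_nonpos_rlim0 with (r := r / 2); [lra | exact Hwlim | |].
      - intros s Hs. apply Hw. lra.
      - intros s Hs. left. apply Hwneg'. lra. }
    destruct (MVT_cor2 w (fun s => - (s ^ (n - 1) * Rpower (u s) p / c)) (r / 2) r)
      as [t [Ht1 Ht2]]; [lra | intros; apply Hw; lra |].
    specialize (Hwneg' t ltac:(lra)). nra. }
  assert (Hdun : forall r, 0 < r -> du r < 0).
  { intros r Hr. specialize (Hwneg r Hr). unfold w in Hwneg.
    apply Rnot_le_lt. intros Hge.
    assert (0 < r ^ (n - k)) by now apply pow_lt.
    assert (0 <= Rabs (du r) ^ (k - 1)) by (apply pow_le, Rabs_pos).
    assert (0 <= r ^ (n - k) * Rabs (du r) ^ (k - 1)) by nra. nra. }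
  assert (Hflux : forall r, 0 < r -> - w r = flux n k (fun s => - du s) r).
  { intros r Hr. unfold flux, w. rewrite Rabs_left by now apply Hdun.
    replace k with (S (k - 1)) at 4 by lia. simpl. ring. }
  exists (fun r => - du r). split.
  - assumption.
  - intros r Hr. specialize (Hdun r Hr). lra.
  - intros r Hr. rewrite Ropp_involutive. now apply Hdu.
  - intros r Hr. apply derivable_pt_lim_local_ext with (f := fun s => - w s) (d := r);
      [assumption | |].
    + intros s Hs. apply Rabs_def2 in Hs. apply Hflux. lra.
    + eapply derivable_pt_lim_value; [apply derivable_pt_lim_opp; now apply Hw | ring].
  (* A difference quotient below 1 already gives [|u s - u 0| <= s], hence the limit [rho]. *)
  - destruct (Hright 1 ltac:(lra)) as [d [Hd H]].
    apply rlim0_linear_bound with 1 d; [assumption|]. intros s Hs.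
    specialize (H s Hs). rewrite Rabs_div_pos in H by lra.
    rewrite <- Hu0. apply Rmult_lt_compat_r with (r := s) in H; [|lra].
    unfold Rdiv in H. rewrite Rmult_assoc, Rinv_l in H by lra. lra.
  - intros eps Heps. destruct (Hwlim eps Heps) as [d [Hd H]].
    exists d. split; [assumption|]. intros s Hs. rewrite <- Hflux by lra.
    rewrite Rminus_0_r, Rabs_Ropp. specialize (H s Hs). now rewrite Rminus_0_r in H.
Qed.

Theorem theorem1p2 :
  forall (n k : nat) (p : R),
    (3 <= n)%nat -> (1 < k)%nat -> (2 * k < n)%nat ->
    p > (INR n + 2) * INR k / (INR n - 2 * INR k) ->
    forall (rho : R) (u : R -> R),
      0 < rho -> regular_solution16 n k p rho u ->
      (exists Cst, 1 < Cst /\ exists R0, forall r, R0 < r ->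
          1 / Cst <= u r * Rpower r (2 * INR k / (p - INR k)) <= Cst) /\
      (exists mu, 0 < mu /\
          forall u1 : R -> R, regular_solution16 n k p 1 u1 ->
          forall r, 0 <= r -> u r = Rpower mu (2 * INR k / (p - INR k)) * u1 (mu * r)).
Proof.
  intros n k p _ Hk Hkn Hso rho u Hrho Hu.
  assert (Kpos : 1 < INR k) by (change 1 with (INR 1); now apply lt_INR).
  assert (Hnk : 0 < INR n - 2 * INR k).
  { apply lt_INR in Hkn. rewrite mult_INR in Hkn. simpl (INR 2) in Hkn. lra. }
  assert (Hpk : INR k < p).
  { eapply Rlt_trans; [|exact Hso].
    apply Rmult_lt_reg_r with (INR n - 2 * INR k); [assumption|].
    unfold Rdiv. rewrite Rmult_assoc, Rinv_l, Rmult_1_r by lra. nra. }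
  set (c := 1 / INR k * C (n - 1) (k - 1)).
  assert (Hc : 0 < c).
  { apply Rmult_lt_0_compat; [| apply C_pos]. apply Rdiv_lt_0_compat; lra. }
  set (alpha := 2 * INR k / (p - INR k)).
  assert (Halpha : 0 < alpha) by (apply Rdiv_lt_0_compat; lra).
  destruct (regular_solution_flow n k p rho u Hk Hkn Hu) as [V HV]. fold c in HV.
  split.
  - destruct (rescaled_upper_bound n k p c Hk Hkn Hpk Hc rho u V HV) as [M [HM HMr]].
    destruct (rescaled_lower_bound n k p c Hk Hkn Hpk Hc rho u V HV) as [m [r0 [Hm [Hr0 Hmr]]]];
      [assumption|].
    fold alpha in HMr, Hmr.
    assert (Hm' : 0 < / m) by now apply Rinv_0_lt_compat.
    exists (1 + M + / m). split; [lra|].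
    exists r0. intros r Hr. split.
    + apply Rle_trans with m; [| apply Hmr; lra].
      apply Rmult_le_reg_r with (1 + M + / m); [lra|].
      unfold Rdiv. rewrite Rmult_assoc, Rinv_l by lra.
      rewrite !Rmult_plus_distr_l, Rinv_r by lra. nra.
    + specialize (HMr r ltac:(lra)). lra.
  (* [mu^alpha = rho] makes the rescaled [u1] start at [rho]. *)
  - exists (Rpower rho (/ alpha)). split; [apply Rpower_pos|].
    intros u1 Hu1 r Hr.
    assert (Hmu : Rpower (Rpower rho (/ alpha)) alpha = rho).
    { rewrite Rpower_mult, Rinv_l by lra. now apply Rpower_1. }
    (* The flow describes [r > 0]; at [r = 0] both sides are [rho] by the initial values. *)
    destruct Hr as [Hr|<-].
    + destruct (regular_solution_flow n k p 1 u1 Hk Hkn Hu1) as [V1 HV1]. fold c in HV1.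
      pose proof (radial_flow_scale n k p c Hk Hkn Hpk Hc (Rpower rho (/ alpha)) 1 u1 V1
        (Rpower_pos _ _) HV1) as HV1'.
      cbv zeta in HV1'. fold alpha in HV1'. rewrite Hmu, Rmult_1_r in HV1'.
      rewrite Hmu.
      exact (radial_flow_unique n k p c Hk Hkn Hpk Hc rho _ _ _ _ r HV HV1' Hr).
    + destruct Hu as [[Hu0 _] _]. destruct Hu1 as [[Hu10 _] _].
      rewrite Rmult_0_r, Hu0, Hu10, Hmu. ring.
Qed.
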